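(* Let $\mathbb{K}$ be a field, $S=\mathbb{K}[x_1,\dots,x_n]$, and let $I\subset S$ be a monomial ideal. Then for every integer $k\geq 1$, $${\rm sdepth}(\overline{I^k}) \leq {\rm sdepth}(\overline{I})\quad\text{and}\quad {\rm sdepth}(S/\overline{I^k}) \leq {\rm sdepth}(S/\overline{I}).$$
   Context: $S=\mathbb{K}[x_1,\dots,x_n]$ is the polynomial ring over a field $\mathbb{K}$ with its standard $\mathbb{Z}^n$-grading ($\deg x_i=e_i$). Stanley depth: let $M$ be a finitely generated $\mathbb{Z}^n$-graded $S$-module. For a homogeneous element $u\in M$ and a subset $Z\subseteq\{x_1,\dots,x_n\}$, let $u\mathbb{K}[Z]$ be the $\mathbb{K}$-subspace of $M$ generated by all elements $uv$ with $v\in\mathbb{K}[Z]$. It is called a Stanley space of dimension $|Z|$ if it is a free $\mathbb{K}[Z]$-module. A Stanley decomposition $\mathcal{D}$ of $M$ is a decomposition of $M$ (as a $\mathbb{K}$-vector space) as a finite direct sum of Stanley spaces. The Stanley depth ${\rm sdepth}(\mathcal{D})$ is the minimum dimension of a Stanley space in $\mathcal{D}$, and ${\rm sdepth}(M)$ is the maximum of ${\rm sdepth}(\mathcal{D})$ over all Stanley decompositions $\mathcal{D}$ of $M$. Convention: ${\rm sdepth}(0)=\infty$ (empty decomposition). Integral closure: for an ideal $I\subseteq S$, an element $f\in S$ is integral over $I$ if there is an equation $f^m+c_1f^{m-1}+\dots+c_{m-1}f+c_m=0$ with $m\ge 1$ and $c_i\in I^i$. The integral closure $\overline{I}$ is the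 set of all elements of $S$ integral over $I$. For a monomial ideal $I$, it is known that $\overline{I}$ is the monomial ideal generated by all monomials $u\in S$ such that $u^m\in I^m$ for some integer $m\geq 1$. *)

(* Defs.v *)
From mathcomp Require Import all_boot all_order all_algebra.
From mathcomp Require Import mpoly.
From mathcomp Require Import boolp classical_sets constructive_ereal.

Set Implicit Arguments.
Unset Strict Implicit.
Unset Printing Implicit Defensive.

Import Order.TTheory GRing.Theory Num.Theory.
Local Open Scope classical_set_scope.
Local Open Scope ring_scope.

Section Ideals.
Variable R : comNzRingType.

(* The ideal generated by [A]: finite sums of multiples of elements of [A]. *)
Definition ideal_gen (A : set R) : set R :=
  [set f | exists s : seq (R * R),
     (forall p, p \in s -> A p.2) /\ f = \sum_(p <- s) p.1 * p.2].

Definition ideal_mul (I J : set R) : set R :=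
  ideal_gen [set h | exists f g, [/\ I f, J g & h = f * g]].

Fixpoint ideal_exp (I : set R) (k : nat) : set R :=
  if k is k'.+1 then ideal_mul I (ideal_exp I k') else [set: R].

Definition integral_over_ideal (I : set R) (f : R) : Prop :=
  exists (m : nat) (c : nat -> R),
    [/\ (0 < m)%N,
        (forall i, (1 <= i <= m)%N -> ideal_exp I i (c i)) &
        f ^+ m + \sum_(1 <= i < m.+1) c i * f ^+ (m - i) = 0].

Definition integral_closure (I : set R) : set R :=
  [set f | integral_over_ideal I f].

End Ideals.

Section StanleyDepth.
Variables (K : fieldType) (n : nat).
Local Notation S := {mpoly K[n]}.

Definition monomial_ideal (I : set S) : Prop :=
  exists A : set 'X_{1..n}, I = ideal_gen [set 'X_[m] | m in A].

(* K[Z], for [Z] a set of variables given by their indices. *)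
Definition subpoly (Z : {set 'I_n}) : set S :=
  [set v | forall m, m \in msupp v -> forall i, i \notin Z -> m i = 0%N].

(* A Z^n-graded S-module is presented as a subquotient [P / N] of an S-module
   [V] with homogeneous components [grade a], where [N `<=` P] are graded
   submodules of [V]: its elements are those of [P], equality is congruence
   modulo [N], and the component of degree [a] is the image of the elements of
   [P] of degree [a].  Any module [M] arises with [V = P = M] and [N = 0]; an
   ideal [J] of S is [J / 0], and S / J is [setT / J].  This avoids building a
   quotient type for each [J], and in particular does not presuppose a proof
   that [J] is an ideal. *)
Section Subquotient.
Variables (V : lmodType S) (grade : ('I_n -> int) -> set V) (P N : set V).

Definition homogeneous (u : V) : Prop := exists a, grade a u.

(* u K[Z] is a Stanley space of P / N: [u] is homogeneous and u K[Z] is free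
   over K[Z] with basis the class of [u].  In particular that class is not 0,
   and u K[Z] has rank one. *)
Definition stanley_space (u : V) (Z : {set 'I_n}) : Prop :=
  [/\ P u, homogeneous u & forall v, subpoly Z v -> N (v *: u) -> v = 0].

(* [D] lists pairs (u, Z).  The second and third clauses say that P / N is the
   sum of the subspaces u K[Z], and that this sum is direct. *)
Definition stanley_decomposition (D : seq (V * {set 'I_n})) : Prop :=
  [/\ forall p, p \in D -> stanley_space p.1 p.2,
      forall f, P f -> exists v : 'I_(size D) -> S,
        (forall i, subpoly (tnth (in_tuple D) i).2 (v i)) /\
        N (f - \sum_i v i *: (tnth (in_tuple D) i).1) &
      forall v : 'I_(size D) -> S,
        (forall i, subpoly (tnth (in_tuple D) i).2 (v i)) ->
        N (\sum_i v i *: (tnth (in_tuple D) i).1) ->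
        forall i, N (v i *: (tnth (in_tuple D) i).1)].

(* The minimum over the empty decomposition is +oo. *)
Definition sdepth_decomposition (D : seq (V * {set 'I_n})) : \bar int :=
  \big[Order.min/+oo%E]_(p <- D) (#|p.2|%:Z)%:E.

(* The values of [sdepth_decomposition] lie in {0, ..., n, +oo}, so that the
   supremum of a nonempty set of them is its maximum. *)
Definition sdepth : \bar int :=
  supremum -oo%E [set sdepth_decomposition D | D in stanley_decomposition].

End Subquotient.

(* The standard grading of S, deg x_i = e_i. *)
Definition mpoly_grade (a : 'I_n -> int) : set S^o :=
  [set f : S | forall m, m \in msupp f -> forall i, (m i)%:Z = a i].

Definition sdepth_ideal (J : set S) : \bar int :=
  sdepth mpoly_grade (J : set S^o) [set 0].

Definition sdepth_quotient (J : set S) : \bar int :=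
  sdepth mpoly_grade [set: S^o] (J : set S^o).

End StanleyDepth.

(* Main.v *)
(* A monomial x^m is integral over a monomial ideal I iff x^(rm) lies in I^r for
   some r >= 1, hence x^m lies in the closure of I iff x^(km) lies in the closure
   of I^k.  A Stanley decomposition of the closure of I^k (or of its quotient) is
   a partition of the exponents into cones u + N^Z; the preimage of such a cone
   under m |-> km is empty or a cone with the same Z, which yields a
   decomposition for I of no smaller depth.

   Sums of integral elements are integral by passing to the Rees algebra.  That
   every monomial of an integral element f is integral is seen after adjoining a
   transcendental z to the coefficients: the scalings x_j |-> z x_j preserve the
   closure and isolate a nonzero multiple of each monomial of f. *)
Require Import Defs.
From HB Require Import structures.
From mathcomp Require Import all_boot all_order all_algebra.
From mathcomp Require Import mpoly.
From mathcomp Require Import boolp classical_sets constructive_ereal.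

Set Implicit Arguments.
Unset Strict Implicit.
Unset Printing Implicit Defensive.

Import Order.TTheory GRing.Theory Num.Theory.
Local Open Scope classical_set_scope.
Local Open Scope ring_scope.

(** * Sums and products in the powers of an ideal *)

Section IdealPowers.
Variable R : comNzRingType.
Implicit Types (A I J : set R) (f g : R).

Lemma ideal_gen_sub A J : J 0 -> (forall f g, J f -> J g -> J (f + g)) ->
  (forall a f, A f -> J (a * f)) -> ideal_gen A `<=` J.
Proof.
move=> J0 JD AJ f [s [sA ->]]; rewrite big_seq.
by elim/big_ind: _ => // p /sA; apply: AJ.
Qed.

Lemma ideal_gen0 A : ideal_gen A 0.
Proof. by exists [::]; rewrite big_nil. Qed.

Lemma mem_ideal_gen A f : A f -> ideal_gen A f.
Proof.
move=> Af; exists [:: (1, f)]; rewrite big_seq1 mul1r; split=> // p.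
by rewrite inE => /eqP ->.
Qed.

Lemma ideal_genD A f g : ideal_gen A f -> ideal_gen A g -> ideal_gen A (f + g).
Proof.
move=> [s [sA ->]] [t [tA ->]]; exists (s ++ t); rewrite big_cat; split=> // p.
by rewrite mem_cat => /orP[/sA|/tA].
Qed.

Lemma ideal_genM A a f : ideal_gen A f -> ideal_gen A (a * f).
Proof.
move=> [s [sA ->]]; exists [seq (a * p.1, p.2) | p <- s]; split.
  by move=> _ /mapP[p /sA ? ->].
by rewrite big_map big_distrr; apply: eq_bigr => p _; rewrite /= mulrA.
Qed.

Lemma ideal_exp0 I k : ideal_exp I k 0.
Proof. by case: k => // k; apply: ideal_gen0. Qed.

Lemma ideal_expD I k f g :
  ideal_exp I k f -> ideal_exp I k g -> ideal_exp I k (f + g).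
Proof. by case: k => // k; apply: ideal_genD. Qed.

Lemma ideal_expMl I k a f : ideal_exp I k f -> ideal_exp I k (a * f).
Proof. by case: k => // k; apply: ideal_genM. Qed.

Lemma ideal_expN I k f : ideal_exp I k f -> ideal_exp I k (- f).
Proof. by rewrite -mulN1r; apply: ideal_expMl. Qed.

Lemma ideal_exp_sum I k (T : eqType) (s : seq T) (P : pred T) (F : T -> R) :
  (forall i, i \in s -> P i -> ideal_exp I k (F i)) ->
  ideal_exp I k (\sum_(i <- s | P i) F i).
Proof.
move=> IF; rewrite big_seq_cond; elim/big_ind: _ => [|f g|i /andP[]].
- exact: ideal_exp0.
- exact: ideal_expD.
- exact: IF.
Qed.

Lemma ideal_expM I a b f g :
  ideal_exp I a f -> ideal_exp I b g -> ideal_exp I (a + b) (f * g).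
Proof.
move=> + Ig; elim: a f => [|a IH] f; first by move=> _; apply: ideal_expMl.
move: f; apply: (@ideal_gen_sub _ [set f | ideal_exp I (a.+1 + b) (f * g)]).
- by rewrite -[_ 0]/(ideal_exp _ _ _) mul0r; apply: ideal_exp0.
- by move=> f h If Ih; rewrite -[_ (f + h)]/(ideal_exp _ _ _) mulrDl; apply: ideal_expD.
move=> c _ [f [h [If Ih ->]]].
rewrite -[_ (c * _)]/(ideal_exp _ _ _) -!mulrA; apply: ideal_expMl.
by apply: mem_ideal_gen; exists f, (h * g); split=> //; apply: IH.
Qed.

End IdealPowers.

(** * The Rees algebra, the sum of the I^i t^i inside R[t], with t written ['X] *)

Section Rees.
Variables (R : comNzRingType) (I : set R).

Definition rees : {pred {poly R}} := fun p => `[< forall i, ideal_exp I i p`_i >].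

Lemma reesP (p : {poly R}) :
  reflect (forall i, ideal_exp I i p`_i) (p \in rees).
Proof. exact: asboolP. Qed.

Lemma rees_subring_closed : subring_closed rees.
Proof.
split=> [|p q /reesP Ip /reesP Iq|p q /reesP Ip /reesP Iq]; apply/reesP => i.
- by rewrite coef1; case: i => // i; apply: ideal_exp0.
- by rewrite coefB; apply: ideal_expD => //; apply: ideal_expN.
rewrite coefM; apply: ideal_exp_sum => j _ _.
have {1}-> : i = (j + (i - j))%N by rewrite subnKC // -ltnS.
exact: ideal_expM.
Qed.

HB.instance Definition _ :=
  GRing.isSubringClosed.Build {poly R} rees rees_subring_closed.

Record rees_alg := ReesAlg { rees_val : {poly R}; _ : rees_val \in rees }.

HB.instance Definition _ := [isSub for rees_val].
HB.instance Definition _ := [Choice of rees_alg by <:].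
HB.instance Definition _ := [SubChoice_isSubComNzRing of rees_alg by <:].

HB.instance Definition _ :=
  GRing.RMorphism.copy rees_val (\val : rees_alg -> {poly R}).

(** Multiplying an equation of degree m for f by t^m makes it a monic equation for f t with
    coefficients c_i t^i; conversely, the part of degree m in t of an equation for f t is an
    equation for f. Integrality over an ideal thus becomes integrality over a ring, where closure
    under sums is available. *)
Lemma integral_over_ideal_rees f :
  integral_over_ideal I f <-> integralOver rees_val (f *: 'X).
Proof.
split=> [[m [c [m_gt0 Ic eq_f]]]|[p p_monic]].
  (* The default 0 is never met for 1 <= i <= m, since c_i t^i then lies in the Rees algebra. *)
  pose e i : rees_alg := insubd 0 (c i *: 'X^i).
  have eE i : (1 <= i <= m)%N -> rees_val (e i) = c i *: 'X^i.
    move=> /Ic Ici; rewrite insubdK //; apply/reesP => j.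
    by rewrite coefZ coefXn; case: eqP => [->|_]; rewrite ?mulr1 ?mulr0 //;
       apply: ideal_exp0.
  exists ('X^m + \sum_(1 <= i < m.+1) (e i)%:P * 'X^(m - i)).
    rewrite monicE lead_coefDl ?lead_coefXn // size_polyXn ltnS.
    apply/leq_sizeP => j mj; rewrite coef_sum big_nat big1 // => i /andP[i0 im].
    rewrite coefCM coefXn; case: eqP => [jE|]; rewrite ?mulr0 //.
    by move: mj; rewrite jE leqNgt ltn_subrL i0 m_gt0.
  rewrite rmorphD /= map_polyXn rmorph_sum /root hornerD hornerXn horner_sum.
  suff -> : \sum_(1 <= i < m.+1)
      (map_poly rees_val ((e i)%:P * 'X^(m - i))).[f *: 'X] =
      (\sum_(1 <= i < m.+1) c i * f ^+ (m - i)) *: 'X^m.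
    by rewrite exprZn -scalerDl eq_f scale0r.
  rewrite scaler_suml !big_nat; apply: eq_bigr => i /andP[i0 im].
  rewrite rmorphM /= map_polyXn map_polyC hornerM hornerC hornerXn /=.
  rewrite eE ?i0 // exprZn -scalerAl -scalerAr scalerA -exprD subnKC //.
rewrite /root horner_coef size_map_inj_poly //; last exact: val_inj.
case sp: (size p) => [|m]; first by move/monic_neq0: p_monic; rewrite -size_poly_eq0 sp.
have p_m : p`_m = 1 by move/monicP: p_monic; rewrite lead_coefE sp.
(* Comparing coefficients of t^m: the term in (f t)^(m - i) contributes f^(m - i) times the
   coefficient of t^i in p_(m - i), which lies in I^i. *)
rewrite big_ord_recr /= coef_map /= p_m => /eqP/(congr1 (fun q : {poly R} => q`_m)).
rewrite coefD exprZn mul1r coefZ coefXn eqxx mulr1 coef0 addrC coef_sum => eq_f.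
exists m, (fun i => (rees_val p`_(m - i))`_i); split.
(* For m = 0 the equation would read 1 = 0. *)
- case: m sp p_m eq_f => // _ _; rewrite big_ord0 addr0 expr0 => /eqP.
  by rewrite oner_eq0.
- by move=> i _; case: (p`_(m - i)) => q /= /reesP.
rewrite -{}[RHS]eq_f; congr (_ + _); rewrite big_add1 /= big_mkord.
rewrite [RHS](reindex_inj rev_ord_inj) /=; apply: eq_bigr => i _.
rewrite coef_map exprZn -scalerAr coefZ coefMXn ltnNge leq_subr /= subKn //.
by rewrite mulrC.
Qed.

End Rees.

(** * Stability properties of the integral closure *)

Section IntegralClosure.
Variable R : comNzRingType.
Implicit Types (I : set R) (f g : R).

Lemma integral_closureD I f g :
  integral_closure I f -> integral_closure I g -> integral_closure I (f + g).
Proof.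
move=> /integral_over_ideal_rees If /integral_over_ideal_rees Ig.
by apply/integral_over_ideal_rees; rewrite scalerDl; apply: integral_add.
Qed.

Lemma integral_closureMl I a f :
  integral_closure I f -> integral_closure I (a * f).
Proof.
move=> [m [c [m0 Ic eq_f]]]; exists m, (fun i => a ^+ i * c i); split=> //.
  by move=> i /Ic; apply: ideal_expMl.
rewrite -[RHS](mulr0 (a ^+ m)) -[in RHS]eq_f mulrDr exprMn big_distrr /=; congr (_ + _).
rewrite [LHS]big_nat [RHS]big_nat; apply: eq_bigr => i /andP[i0 im].
by rewrite exprMn mulrACA -exprD subnKC.
Qed.

Lemma integral_closure0 I : integral_closure I 0.
Proof.
exists 1%N, (fun=> 0); split=> // [i _|]; first exact: ideal_exp0.
by rewrite big_nat1 expr1 mul0r addr0.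
Qed.

(** Serves for the extension of coefficients from K to K[z] and for the scalings of a variable. *)
Lemma integral_closure_morph (R' : comNzRingType) (phi : {rmorphism R -> R'})
    I (I' : set R') :
  (forall i f, ideal_exp I i f -> ideal_exp I' i (phi f)) ->
  forall f, integral_closure I f -> integral_closure I' (phi f).
Proof.
move=> phiI f [m [c [m0 Ic eq_f]]]; exists m, (phi \o c); split=> //.
  by move=> i /Ic; apply: phiI.
rewrite -[RHS](rmorph0 phi) -[in RHS]eq_f rmorphD rmorphXn rmorph_sum; congr (_ + _).
by apply: eq_bigr => i _; rewrite rmorphM rmorphXn.
Qed.

End IntegralClosure.

(** * Monomial ideals, their powers and their integral closures in terms of exponents *)

Section MonomialIdeals.
Variable n : nat.
Implicit Types (A E : set 'X_{1..n}) (m : 'X_{1..n}).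

(* The exponents of the monomials in the [k]-th power of the ideal generated by
   the monomials with exponents in [A]. *)
Fixpoint expnt_exp A (k : nat) : set 'X_{1..n} :=
  if k is k'.+1 then
    [set m | exists a b, [/\ A a, expnt_exp A k' b & m = (a + b)%MM]]
  else setT.

Lemma expnt_expDr A k m m' : expnt_exp A k m -> expnt_exp A k (m + m')%MM.
Proof.
elim: k m => // k IH m [a [b [Aa Ab ->]]]; exists a, (b + m')%MM.
by rewrite addmA; split=> //; apply: IH.
Qed.

Lemma expnt_expD A a b m m' :
  expnt_exp A a m -> expnt_exp A b m' -> expnt_exp A (a + b) (m + m')%MM.
Proof.
move=> + Am'; elim: a m => [|a IH] m.
  by move=> _; rewrite addmC; apply: expnt_expDr.
move=> [c [d [Ac Ad ->]]]; exists c, (d + m')%MM.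
by rewrite addmA; split=> //; apply: IH.
Qed.

Lemma expnt_expD_inv A a b m : expnt_exp A (a + b) m ->
  exists m1 m2, [/\ expnt_exp A a m1, expnt_exp A b m2 & m = (m1 + m2)%MM].
Proof.
elim: a m => [|a IH] m; first by exists 0%MM, m; rewrite add0m.
move=> [c [d [Ac /IH[m1 [m2 [Am1 Am2 ->]]] ->]]].
by exists (c + m1)%MM, m2; rewrite addmA; split=> //; exists c, m1.
Qed.

Lemma expnt_expM A k r : expnt_exp (expnt_exp A k) r = expnt_exp A (k * r).
Proof.
elim: r => [|r IH]; first by rewrite muln0.
rewrite mulnS; apply/seteqP; split=> m /=.
  by move=> [a [b [Aa + ->]]]; rewrite IH; apply: expnt_expD.
by move=> /expnt_expD_inv[a [b [Aa Ab ->]]]; exists a, b; rewrite IH.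
Qed.

Lemma expnt_exp_mulmn A k r m :
  expnt_exp A k m -> expnt_exp A (k * r) (m *+ r)%MM.
Proof.
move=> Am; elim: r => [|r IH]; first by rewrite muln0.
by rewrite mulnS mulmS; apply: expnt_expD.
Qed.

Section Coefficients.
Variable R : comNzRingType.
Implicit Types f g : {mpoly R[n]}.

(** Every ideal of the proof is brought to this form, which turns membership into a condition on
    exponents. *)
Definition monomial_span E : set {mpoly R[n]} :=
  [set f | forall m, m \in msupp f -> E m].

Lemma monomial_span0 E : monomial_span E 0.
Proof. by move=> m; rewrite msupp0. Qed.

Lemma monomial_spanD E f g :
  monomial_span E f -> monomial_span E g -> monomial_span E (f + g).
Proof. by move=> Ef Eg m /msuppD_le; rewrite mem_cat => /orP[/Ef|/Eg]. Qed.

Lemma monomial_spanM E1 E2 E f g :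
  (forall a b, E1 a -> E2 b -> E (a + b)%MM) ->
  monomial_span E1 f -> monomial_span E2 g -> monomial_span E (f * g).
Proof.
move=> EE fE gE m /msuppM_le/allpairsP[[a b] /= [/fE Ea /gE Eb ->]].
exact: EE.
Qed.

Lemma monomial_spanX E m : monomial_span E 'X_[m] <-> E m.
Proof.
split=> [|Em m']; first by apply; rewrite msuppX inE.
by rewrite msuppX inE => /eqP ->.
Qed.

Lemma monomial_span_sub E (J : set {mpoly R[n]}) : J 0 ->
  (forall f g, J f -> J g -> J (f + g)) -> (forall a f, J f -> J (a * f)) ->
  (forall m, E m -> J 'X_[m]) -> monomial_span E `<=` J.
Proof.
move=> J0 JD JM JE f Ef; rewrite [f]mpolyE big_seq.
elim/big_ind: _ => // m /Ef/JE; rewrite -mul_mpolyC; exact: JM.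
Qed.

Definition expnt_ideal A : set {mpoly R[n]} := ideal_gen [set 'X_[m] | m in A].

Lemma expnt_idealE A :
  expnt_ideal A = monomial_span [set m | exists2 a, A a & (a <= m)%MM].
Proof.
apply/seteqP; split.
  apply: ideal_gen_sub; [exact: monomial_span0|exact: monomial_spanD|].
  move=> f _ [a Aa <-]; apply: (@monomial_spanM setT [set a]).
  - by move=> m _ _ ->; exists a => //; apply: lem_addl.
  - by [].
  - exact/monomial_spanX.
apply: monomial_span_sub => [|||m [a Aa am]].
- exact: ideal_gen0.
- exact: ideal_genD.
- exact: ideal_genM.
rewrite -(submK am) mpolyXD; apply/ideal_genM/mem_ideal_gen.
by exists a.
Qed.

(** The recursion of [expnt_exp] ends in [setT], so its sets are stable under adding any exponent,
    and their monomials span the power instead of merely generating it. *)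
Lemma ideal_exp_monomial A k :
  ideal_exp (expnt_ideal A) k = monomial_span (expnt_exp A k).
Proof.
elim: k => [|k IH]; apply/seteqP; split.
- by [].
- by [].
- apply: ideal_gen_sub; [exact: monomial_span0|exact: monomial_spanD|].
  move=> f _ [g [h [Ag Ah ->]]]; apply: (@monomial_spanM setT (expnt_exp A k.+1)).
  + by move=> a b _; rewrite addmC; apply: expnt_expDr.
  + by [].
  rewrite expnt_idealE in Ag; rewrite -/(ideal_exp _ _) IH in Ah.
  (* The generator c is kept as the first summand and the surplus a - c is moved to the other
     factor. *)
  apply: monomial_spanM Ag Ah => a b [c Ac /submK <-] Ab.
  exists c, ((a - c) + b)%MM; split=> //; last by rewrite addmA [(c + _)%MM]addmC.
  by rewrite addmC; apply: expnt_expDr.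
apply: monomial_span_sub => [|||m [a [b [Aa Ab ->]]]].
- exact: ideal_gen0.
- exact: ideal_genD.
- exact: ideal_genM.
rewrite mpolyXD; apply: mem_ideal_gen; exists 'X_[a], 'X_[b]; split=> //.
  by apply: mem_ideal_gen; exists a.
by rewrite -/(ideal_exp _ _) IH; apply/monomial_spanX.
Qed.

(** Puts the power back in the form of a generated monomial ideal, so that the description of
    integral closures applies to it. *)
Lemma ideal_exp_expnt_ideal A k :
  ideal_exp (expnt_ideal A) k = expnt_ideal (expnt_exp A k).
Proof.
rewrite ideal_exp_monomial expnt_idealE; congr monomial_span.
apply/seteqP; split=> [m Am|m [a Aa /submK <-]].
  by exists m => //; apply/mnm_lepP.
by rewrite addmC; apply: expnt_expDr.
Qed.

Definition scale_var (z : R) (j : 'I_n) : {mpoly R[n]} -> {mpoly R[n]} :=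
  comp_mpoly [tuple (if i == j then z *: 'X_i else 'X_i) | i < n].

Lemma mcoeff_scale_var z j f m : (scale_var z j f)@_m = z ^+ m j * f@_m.
Proof.
have scaleX m' : scale_var z j 'X_[m'] = z ^+ m' j *: 'X_[m'].
  rewrite /scale_var comp_mpolyX [in RHS]mpolyXE_id (bigD1 j) //=.
  rewrite [in RHS](bigD1 j) //= tnth_mktuple eqxx exprZn -scalerAl.
  congr (_ *: (_ * _)); apply: eq_bigr => i /negPf ij.
  by rewrite tnth_mktuple ij.
have -> : scale_var z j f = \sum_(m' <- msupp f) f@_m' *: (z ^+ m' j *: 'X_[m']).
  by rewrite /scale_var comp_mpolyEX; apply: eq_bigr => m' _; rewrite -scaleX.
rewrite [in RHS](mpolyE f) !raddf_sum big_distrr /=; apply: eq_bigr => m' _.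
rewrite !mcoeffZ mcoeffX; case: eqP => [->|_]; last by rewrite !mulr0.
by rewrite !mulr1 mulrC.
Qed.

End Coefficients.

(* The torus scalings [scale_var z j] act on a monomial by a character, so
   [scale_var z j f - z ^+ m0 j *: f] loses the monomial [m0] but keeps every
   monomial whose [j]-th exponent differs from [m0 j]. *)
Lemma isolate_monomial (R : idomainType) (z : R) (J : set {mpoly R[n]}) :
  injective (fun a : nat => z ^+ a) ->
  (forall f g, J f -> J g -> J (f + g)) -> (forall a f, J f -> J (a * f)) ->
  (forall j f, J f -> J (scale_var z j f)) ->
  forall f m, J f -> m \in msupp f -> exists2 c, c != 0 & J (c *: 'X_[m]).
Proof.
move=> z_inj JD JM JT f m.
elim: {f}_.+1 {-2}f (ltnSn (size (msupp f))) => // N IH f sf Jf mf.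
have [[m0 [m0f m0m]]|only_m] :=
  pselect (exists m0, m0 \in msupp f /\ m0 <> m); last first.
  exists f@_m; first by rewrite -mcoeff_msupp.
  rewrite (_ : _ *: _ = f) //; apply/mpolyP => m'; rewrite mcoeffZ mcoeffX.
  case: eqP => [<-|mm']; first by rewrite mulr1.
  rewrite mulr0; apply/esym/memN_msupp_eq0/negP => m'f.
  by apply: only_m; exists m'; split=> // ?; apply: mm'.
have [j m0j] : exists j, m0 j <> m j.
  by apply/existsNP => m0E; apply: m0m; apply/mnmP.
pose g := scale_var z j f + (- z ^+ m0 j)%:MP * f.
have gE m' : g@_m' = (z ^+ m' j - z ^+ m0 j) * f@_m'.
  by rewrite mcoeffD mcoeffCM mcoeff_scale_var mulrDl.
apply: (IH g); last 1 first.
- rewrite mcoeff_msupp gE mulf_neq0 -?mcoeff_msupp // subr_eq0.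
  by apply/eqP => /z_inj E; apply: m0j.
- have g_sub : {subset m0 :: msupp g <= msupp f}.
    move=> m'; rewrite inE => /predU1P[-> //|].
    rewrite !mcoeff_msupp gE; apply: contraNneq => ->; by rewrite mulr0.
  rewrite -ltnS; apply: leq_trans sf; rewrite ltnS.
  apply: (@uniq_leq_size _ (m0 :: msupp g)) => //=; rewrite msupp_uniq andbT.
  by rewrite mcoeff_msupp gE subrr mul0r eqxx.
by apply: JD; [apply: JT|apply: JM].
Qed.

(** If x^(rm) lies in I^r, then x^m is a root of T^r - x^(rm). Conversely, a nonzero multiple c x^m
    of each monomial of f is integral over K[z], and its equation is read off at the exponent rm. *)
Lemma integral_closure_monomial (K : fieldType) A :
  integral_closure (expnt_ideal A : set {mpoly K[n]}) =
  monomial_span [set m | exists2 r, (0 < r)%N & expnt_exp A r (m *+ r)%MM].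
Proof.
apply/seteqP; split=> [f If m mf|]; last first.
  apply: monomial_span_sub => [|||m [r r0 Am]].
  - exact: integral_closure0.
  - exact: integral_closureD.
  - exact: integral_closureMl.
  exists r, (fun i => if i == r then - 'X_[m *+ r] else 0); split=> //.
    move=> i _; case: eqP => [->|_]; last exact: ideal_exp0.
    by apply: ideal_expN; rewrite ideal_exp_monomial; apply/monomial_spanX.
  rewrite big_nat_recr //= eqxx subnn expr0 mulr1 big_nat big1 ?add0r.
    by rewrite mpolyXn subrr.
  by move=> i /andP[_ ir]; rewrite ltn_eqF // mul0r.
(* The powers of z in K[z] are distinct even when K is finite, as the isolation of monomials
   requires. *)
pose phi : {rmorphism _ -> _} := @map_mpoly n K {poly K} (@polyC K).
pose J := integral_closure (expnt_ideal A : set {mpoly {poly K}[n]}).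
have phi_supp g : {subset msupp (phi g) <= msupp g}.
  move=> m'; rewrite !mcoeff_msupp /= mcoeff_map_mpoly.
  by apply: contraNneq => ->; rewrite raddf0.
have Jf : J (phi f).
  apply: integral_closure_morph If => i g; rewrite !ideal_exp_monomial.
  by move=> Ag m' /phi_supp/Ag.
have [] := @isolate_monomial {poly K} 'X J _ _ _ _ (phi f) m Jf.
- by move=> a b /(congr1 (size : {poly K} -> nat)); rewrite !size_polyXn => -[].
- exact: integral_closureD.
- exact: integral_closureMl.
- move=> j g; apply: integral_closure_morph => i {}g; rewrite !ideal_exp_monomial.
  move=> Ag m'; rewrite mcoeff_msupp mcoeff_scale_var => nz; apply: Ag.
  by rewrite mcoeff_msupp; apply: contraNneq nz => ->; rewrite mulr0.
- by rewrite mcoeff_msupp /= mcoeff_map_mpoly /= polyC_eq0 -mcoeff_msupp.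
move=> c c0 [r [a [r0 Aa /(congr1 (mcoeff (m *+ r)%MM))]]].
(* The coefficient of x^(rm) in the equation is c^r plus the sum of c^(r - i) times the coefficient
   of x^(im) in a_i. As c^r is nonzero, some a_i in I^i contains x^(im). *)
have [[i [ir ai]] _|no_i] := pselect (exists i, (1 <= i <= r)%N /\ (a i)@_(m *+ i)%MM != 0).
  case/andP: (ir) => i0 _; exists i => //.
  by move: (Aa i ir); rewrite ideal_exp_monomial; apply; rewrite mcoeff_msupp.
rewrite mcoeffD exprZn mpolyXn mcoeffZ mcoeffX eqxx mulr1 raddf_sum /= big_nat big1.
  by rewrite addr0 mcoeff0 => /eqP; rewrite expf_eq0 (negPf c0) andbF.
move=> i ir; rewrite exprZn mpolyXn -scalerAr mcoeffZ.
have -> : (m *+ r)%MM = (m *+ (r - i) + m *+ i)%MM.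
  by apply/mnmP => l; rewrite mnmDE !mulmnE -mulnDr subnK //; case/andP: ir.
rewrite mcoeffMX; apply/eqP; rewrite mulf_eq0; apply/orP; right.
by apply/negPn/negP => ai; apply: no_i; exists i.
Qed.

End MonomialIdeals.

(** * Stanley decompositions as partitions of exponents into cones, and their k-th roots *)

Section StanleyTransfer.
Variables (K : fieldType) (n : nat).
Local Notation S := {mpoly K[n]}.
Implicit Types (EP EN : set 'X_{1..n}) (p : S * {set 'I_n}) (m : 'X_{1..n}).
Implicit Types (u v f : S) (D : seq (S * {set 'I_n})).

(* [m] is the exponent of a monomial of u K[Z], where [p = (u, Z)] and [u] is
   the product of a monomial by a nonzero constant. *)
Definition cone p m : bool :=
  [forall i, if i \in p.2 then (mlead p.1 i <= m i)%N else mlead p.1 i == m i].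

Lemma cone_mlead p : cone p (mlead p.1).
Proof. by apply/forallP => i; case: ifP. Qed.

Lemma cone_lem p m : cone p m -> (mlead p.1 <= m)%MM.
Proof.
by move=> /forallP mp; apply/mnm_lepP => i; have := mp i; case: ifP => // _ /eqP ->.
Qed.

Lemma cone_subpoly p m : cone p m -> subpoly p.2 ('X_[m - mlead p.1] : S).
Proof.
move=> /forallP mp m'; rewrite msuppX inE => /eqP -> i iZ.
by have := mp i; rewrite (negPf iZ) mnmBE => /eqP ->; rewrite subnn.
Qed.

Lemma cone_msupp p v m : {subset msupp p.1 <= [:: mlead p.1]} ->
  subpoly p.2 v -> m \in msupp (v * p.1) -> cone p m.
Proof.
move=> p1 Zv /msuppM_le/allpairsP[[a b] /= [/Zv Za /p1 + ->]].
rewrite inE => /eqP ->; apply/forallP => i; rewrite mnmDE.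
by case: ifPn => [_|/Za ->]; rewrite ?leq_addl.
Qed.

(** The witness is the part of f supported in the cone, divided by the vertex monomial. *)
Lemma cone_projection p f : p.1 = 'X_[mlead p.1] ->
  exists2 v, subpoly p.2 v & forall m, (v * p.1)@_m = f@_m *+ cone p m.
Proof.
move=> p1; exists (\sum_(m <- msupp f | cone p m) f@_m *: 'X_[m - mlead p.1]).
  elim/big_ind: _ => [m|v w Zv Zw m|m /cone_subpoly Zm m' /msuppZ_le].
  - by rewrite msupp0.
  - by move=> /msuppD_le; rewrite mem_cat => /orP[/Zv|/Zw].
  - exact: Zm.
move=> m; rewrite big_distrl /= raddf_sum /=.
under eq_bigr => m' /cone_lem mm'.
  rewrite {2}p1 -scalerAl -mpolyXD submK // mcoeffZ mcoeffX mulr_natr.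
over.
rewrite [in RHS](mpolyE f) raddf_sum -sumrMnl big_mkcond /=; apply: eq_bigr => m' _.
rewrite mcoeffZ mcoeffX mulr_natr; case: eqP => [->|_]; last by case: ifP; rewrite !mul0rn.
by case: ifP.
Qed.

Lemma count_tnth (T : Type) (a : pred T) (s : seq T) :
  count a s = #|[pred i | a (tnth (in_tuple s) i)]|.
Proof. by rewrite -sum1_count (big_tnth _ _ s) sum1_card. Qed.

(** In the fine grading the degree determines the exponent. *)
Lemma homogeneous_monomial u : u != 0 -> homogeneous (@mpoly_grade K n) u ->
  {subset msupp u <= [:: mlead u]}.
Proof.
move=> u0 [a ua] m mu; rewrite inE; apply/eqP/mnmP => i.
by have := ua _ (mlead_supp u0) i; rewrite -(ua _ mu i) => -[].
Qed.

(** Freeness keeps the cones away from EN, and stability of EP keeps them inside EP. Spanning makes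
    them cover the exponents of EP outside EN, and directness makes them disjoint. *)
Lemma stanley_count EP EN D :
  (forall m m', EP m -> EP (m + m')%MM) ->
  stanley_decomposition (@mpoly_grade K n) (monomial_span EP : set S^o)
    (monomial_span EN : set S^o) D ->
  forall m, count (cone^~ m) D = `[< EP m /\ ~ EN m >].
Proof.
move=> EPD [Dspace Dgen Ddir] m; rewrite count_tnth.
set t := tnth (in_tuple D).
have tD i : t i \in D by apply: mem_tnth.
have t0 i : (t i).1 != 0.
  have [_ _ free] := Dspace _ (tD i).
  apply/eqP => ti0; have /eqP := oner_neq0 S; apply; apply: free.
    by move=> m'; rewrite msupp1 inE => /eqP -> l; rewrite mnm0E.
  by rewrite ti0 scaler0; apply: monomial_span0.
have t_supp i : {subset msupp (t i).1 <= [:: mlead (t i).1]}.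
  by have [_ tih _] := Dspace _ (tD i); apply: homogeneous_monomial.
have tE i : (t i).1 = mleadc (t i).1 *: 'X_[mlead (t i).1].
  apply/mpolyP => m'; rewrite mcoeffZ mcoeffX; case: eqP => [<-|mm'].
    by rewrite mulr1.
  rewrite mulr0; apply: memN_msupp_eq0; apply/negP => /t_supp.
  by rewrite inE => /eqP/esym.
pose w i : S := (mleadc (t i).1)^-1 *: 'X_[m - mlead (t i).1].
have wE i : cone (t i) m -> w i * (t i).1 = 'X_[m].
  move=> /cone_lem im; rewrite [in LHS]tE -scalerAl -scalerAr scalerA -mpolyXD.
  by rewrite submK // mulVf ?scale1r // mleadc_eq0.
have wZ i : cone (t i) m -> subpoly (t i).2 (w i).
  by move=> /cone_subpoly Zm m' /msuppZ_le; apply: Zm.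
have Nw i : cone (t i) m -> ~ monomial_span EN (w i * (t i).1).
  move=> im; have [_ _ free] := Dspace _ (tD i) => /(free _ (wZ i im)) w0.
  have /(congr1 (mcoeff m)) := wE i im.
  by rewrite w0 mul0r mcoeff0 mcoeffX eqxx => /esym/eqP; rewrite oner_eq0.
have [/existsP[i im]|/existsPn no_m] := boolP [exists i, cone (t i) m].
  have -> : `[< EP m /\ ~ EN m >].
    apply/asboolP; split; last first.
      by move=> ENm; apply: (Nw i im); rewrite wE //; apply/monomial_spanX.
    have [Pi _ _] := Dspace _ (tD i).
    by rewrite -(submK (cone_lem im)) addmC; apply/EPD/Pi/mlead_supp.
  apply/eqP; rewrite eqn_leq; apply/andP; split; last by apply/card_gt0P; exists i.
  apply/card_le1_eqP => {i im} i j; rewrite !inE => im jm; apply/eqP/negPn/negP => ij.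
  (* If m lay in two cones, w_i t_i - w_j t_j = 0 would be a relation whose terms are not in N. *)
  pose v l := if l == i then w i else if l == j then - w j else 0.
  have /(Ddir v) : forall l, subpoly (t l).2 (v l).
    move=> l; rewrite /v; case: eqP => [->|_]; first exact: wZ.
    case: eqP => [->|_ m']; last by rewrite msupp0.
    by move=> m'; rewrite (perm_mem (msuppN _)); apply: wZ.
  have -> : \sum_l v l *: ((t l).1 : S^o) = 0.
    rewrite (bigD1 i) //= [X in _ + X](bigD1 j) //=.
    rewrite big1 ?addr0 => [|l /andP[li lj]].
      rewrite /v eqxx (negPf ij) eqxx.
      by rewrite -[X in X + _]/(w i * _) -[X in _ + X]/(- w j * _) mulNr !wE // subrr.
    by rewrite /v (negPf li) (negPf lj) scale0r.
  move=> /(_ (monomial_span0 _) i); rewrite /v eqxx; exact: Nw.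
rewrite eq_card0; last by move=> i; rewrite inE; apply/negbTE/no_m.
apply/esym/eqP; rewrite eqb0; apply/asboolPn => -[EPm nENm]; apply: nENm.
have [v [Zv]] : exists v : 'I_(size D) -> S,
    (forall i, subpoly (t i).2 (v i)) /\
    monomial_span EN ('X_[m] - \sum_i v i * (t i).1).
  by apply: Dgen; apply/monomial_spanX.
(* With m in no cone, no v_i t_i contains x^m, so the difference has coefficient 1 there and m would
   be in EN. *)
apply; rewrite mcoeff_msupp mcoeffB mcoeffX eqxx raddf_sum big1 ?subr0 ?oner_eq0 //.
move=> i _; apply: memN_msupp_eq0; apply: contra (no_m i).
exact: cone_msupp.
Qed.

(** Converse of [stanley_count] for monic monomial vertices: f is split by projecting it to the
    cones, and the remainder has exponents in EN. Disjoint cones exclude cancellation, whence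
    directness. *)
Lemma count_stanley EP EN D :
  (forall p, p \in D -> p.1 = 'X_[mlead p.1]) ->
  (forall m, count (cone^~ m) D = `[< EP m /\ ~ EN m >]) ->
  stanley_decomposition (@mpoly_grade K n) (monomial_span EP : set S^o)
    (monomial_span EN : set S^o) D.
Proof.
move=> DX Dcount.
have supp_mlead p : p \in D -> {subset msupp p.1 <= [:: mlead p.1]}.
  by move=> /DX pX m; rewrite {1}pX msuppX.
have DP p m : p \in D -> cone p m -> EP m /\ ~ EN m.
  move=> pD pm; apply/asboolP; have : (0 < count (cone^~ m) D)%N.
    by rewrite -has_count; apply/hasP; exists p.
  by rewrite Dcount lt0b.
set t := tnth (in_tuple D).
have tD i : t i \in D by apply: mem_tnth.
split=> [p pD|f Pf|v Zv Nv i m].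
- split.
  + rewrite (DX _ pD); apply/monomial_spanX.
    by have [] := DP _ _ pD (cone_mlead p).
  + exists (fun i => (mlead p.1 i)%:Z) => m /(supp_mlead _ pD m).
    by rewrite inE => /eqP ->.
  move=> v Zv Nv; apply/eqP/negPn/negP => v0.
  (* This exponent lies in the cone, hence outside EN, which contradicts v p.1 being in N. *)
  have vp : (mlead v + mlead p.1)%MM \in msupp (v * p.1).
    by rewrite {2}(DX _ pD) (perm_mem (msuppMX _ _)) addmC map_f // mlead_supp.
  have [_] := DP _ _ pD (cone_msupp (supp_mlead _ pD) Zv vp); apply.
  exact: Nv.
- have /choice[v vP] : forall i, exists v, subpoly (t i).2 v /\
      forall m, (v * (t i).1)@_m = f@_m *+ cone (t i) m.
    by move=> i; have [v Zv vE] := cone_projection f (DX _ (tD i)); exists v.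
  exists v; split=> [i|m]; first by have [] := vP i.
  rewrite -[X in f - X]/(\sum_i v i * (t i).1) mcoeff_msupp mcoeffB raddf_sum /=.
  under eq_bigr => i _ do rewrite (vP i).2.
  rewrite sumrMnr.
  (* The projections of f add up at m to f_m times the number of cones containing m. *)
  have -> : (\sum_i cone (t i) m)%N = `[< EP m /\ ~ EN m >].
    rewrite -Dcount count_tnth -sum1_card [RHS]big_mkcond.
    by apply: eq_bigr => i _; rewrite inE; case: cone.
  case: asboolP => [_|nEm]; first by rewrite subrr eqxx.
  rewrite mulr0n subr0 -mcoeff_msupp => mf.
  by apply/not_notP => nENm; apply: nEm; split=> //; apply: Pf.
(* A monomial of v_i t_i belongs to the i-th cone alone, so its coefficient survives unchanged in
   the total sum. *)
have im := cone_msupp (supp_mlead _ (tD i)) (Zv i).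
move=> mi; apply: (Nv m).
rewrite mcoeff_msupp raddf_sum (bigD1 i) //= big1 ?addr0 -?mcoeff_msupp //.
move=> j ji; apply: memN_msupp_eq0; apply: contra ji => mj.
have jm := cone_msupp (supp_mlead _ (tD j)) (Zv j) mj.
have /card_le1_eqP/(_ i j) : (#|[pred i | cone (t i) m]| <= 1)%N.
  by rewrite -(count_tnth (cone^~ m)) Dcount leq_b1.
by rewrite !inE => -> //; apply: im.
Qed.

(** For k > 0, the ceiling of a_i / k in each coordinate. *)
Definition root_mnm (k : nat) (a : 'X_{1..n}) : 'X_{1..n} :=
  [multinom (a i + k.-1) %/ k | i < n]%N.

(* The exponents [m] with [m *+ k] in a given cone form a cone, with vertex the
   [k]-th root of the original vertex rounded up, or are absent altogether. *)
Definition root_decomposition (k : nat) D : seq (S * {set 'I_n}) :=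
  [seq ('X_[root_mnm k (mlead p.1)], p.2) |
     p <- D & [forall i, (i \notin p.2) ==> (k %| mlead p.1 i)%N]].

(** For i in Z, ceil(a/k) <= b iff a <= bk. For i outside Z, a = bk forces k to divide a, and then
    the ceiling is exact. *)
Lemma cone_root k p m : (0 < k)%N ->
  cone ('X_[root_mnm k (mlead p.1)], p.2) m &&
    [forall i, (i \notin p.2) ==> (k %| mlead p.1 i)%N] = cone p (m *+ k)%MM.
Proof.
move=> k0; have ceil_le a b : ((a + k.-1) %/ k <= b)%N = (a <= b * k)%N.
  by rewrite -ltnS ltn_divLR // mulSn addnC -{2}(prednK k0) addSn ltnS leq_add2l.
have ceilK q : ((q * k + k.-1) %/ k = q)%N.
  by rewrite divnMDl // divn_small ?addn0 // prednK.
apply/andP/forallP => [[/forallP pm /forallP pk] i|pm].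
  have := pm i; rewrite /= mleadXm mnmE mulmnE; case: ifPn => iZ.
    by rewrite ceil_le.
  by have /implyP/(_ iZ)/dvdnP[q ->] := pk i; rewrite ceilK => /eqP ->.
split; apply/forallP => i; have := pm i; rewrite mulmnE /=.
  rewrite mleadXm mnmE; case: ifPn => iZ; last by move=> /eqP ->; rewrite ceilK.
  by rewrite ceil_le.
by case: ifPn => // _ /eqP ->; apply: dvdn_mull.
Qed.

(** Surviving entries keep their Z, so the minimum runs over fewer of the same values. *)
Lemma sdepth_root_decomposition k D :
  (@sdepth_decomposition K n S^o D <=
   @sdepth_decomposition K n S^o (root_decomposition k D))%E.
Proof.
rewrite /sdepth_decomposition big_map big_filter.
elim: D => [|p D IH]; first by rewrite !big_nil.
rewrite !big_cons; case: ifP => _.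
  by rewrite le_min !ge_min lexx IH orbT.
by rewrite ge_min IH orbT.
Qed.

Lemma stanley_root EP EN EP' EN' D k : (0 < k)%N ->
  (forall m m', EP m -> EP (m + m')%MM) ->
  (forall m, EP' m <-> EP (m *+ k)%MM) -> (forall m, EN' m <-> EN (m *+ k)%MM) ->
  stanley_decomposition (@mpoly_grade K n) (monomial_span EP : set S^o)
    (monomial_span EN : set S^o) D ->
  stanley_decomposition (@mpoly_grade K n) (monomial_span EP' : set S^o)
    (monomial_span EN' : set S^o) (root_decomposition k D).
Proof.
move=> k0 EPD EPE ENE /(stanley_count EPD) Dcount.
apply: count_stanley => [_ /mapP[p _ ->]|m]; first by rewrite mleadXm.
rewrite count_map count_filter (eq_count (a2 := cone^~ (m *+ k)%MM)).
  rewrite Dcount; congr (nat_of_bool _); apply: asbool_equiv_eq.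
  by split=> -[/EPE Em nEm]; split=> // /ENE.
by move=> p; apply: cone_root.
Qed.

Lemma sdepth_decomposition_values D :
  @sdepth_decomposition K n S^o D = +oo%E \/
  exists2 i, (i <= n)%N & @sdepth_decomposition K n S^o D = (i%:Z)%:E.
Proof.
rewrite /sdepth_decomposition; elim/big_ind: _ => [|x y Hx Hy|p _].
- by left.
- by rewrite minEle; case: ifP.
by right; exists #|p.2| => //; rewrite -[X in (_ <= X)%N]card_ord max_card.
Qed.

(** [supremum] is meaningful only when a least upper bound exists, so a maximum is exhibited: +oo if
    it is in B, else the largest of finitely many integers. *)
Lemma supremum_depths (B : set (\bar int)) x :
  (forall y, B y -> y = +oo%E \/ exists2 i, (i <= n)%N & y = (i%:Z)%:E) ->
  B x -> (x <= supremum -oo%E B)%E.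
Proof.
move=> Bval Bx; apply: ge_supremum_Nmem => //.
suff [b Bb bmax] : exists2 b, B b & forall y, B y -> (y <= b)%E.
  by exists b; split=> [|y]; [exact: bmax|apply].
have [Boo|Boo] := pselect (B +oo%E); first by exists +oo%E => // y _; apply: leey.
have fin y : B y -> exists2 i, (i <= n)%N & y = (i%:Z)%:E.
  by move=> By; have [yoo|//] := Bval _ By; rewrite yoo in By.
have exB : exists i : nat, `[< B (i%:Z)%:E >].
  by have [i _ xi] := fin _ Bx; exists i; apply/asboolP; rewrite -xi.
have bndB (i : nat) : `[< B (i%:Z)%:E >] -> (i <= n)%N.
  by move=> /asboolP /fin[j jn [->]].
case: (ex_maxnP exB bndB) => i /asboolP Bi imax; exists (i%:Z)%:E => // y By.
have [j _ yj] := fin _ By; rewrite yj lee_fin lez_nat imax //.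
by apply/asboolP; rewrite -yj.
Qed.

Lemma le_sdepth_root EP EN EP' EN' k : (0 < k)%N ->
  (forall m m', EP m -> EP (m + m')%MM) ->
  (forall m, EP' m <-> EP (m *+ k)%MM) -> (forall m, EN' m <-> EN (m *+ k)%MM) ->
  (sdepth (@mpoly_grade K n) (monomial_span EP : set S^o)
     (monomial_span EN : set S^o) <=
   sdepth (@mpoly_grade K n) (monomial_span EP' : set S^o)
     (monomial_span EN' : set S^o))%E.
Proof.
(* On the left, an empty set of depths or a missing least upper bound yields the default -oo, and
   nothing is left to prove. *)
move=> k0 EPD EPE ENE; rewrite {1}/sdepth {1}/supremum; case: ifP => _.
  exact: leNye.
case: xgetP => [x _ [_ lub]|_]; last exact: leNye.
apply: lub => _ [D Dst <-]; apply: le_trans (sdepth_root_decomposition k D) _.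
apply: supremum_depths; last by exists (root_decomposition k D) => //; apply: stanley_root Dst.
by move=> _ [D' _ <-]; apply: sdepth_decomposition_values.
Qed.

End StanleyTransfer.

(** * Comparison of the closures of I and I^k *)

Theorem corollary2p2 (K : fieldType) (n : nat) (I : set {mpoly K[n]})
    (hI : monomial_ideal I) (k : nat) (hk : (1 <= k)%N) :
  (sdepth_ideal (integral_closure (ideal_exp I k))
     <= sdepth_ideal (integral_closure I))%E /\
  (sdepth_quotient (integral_closure (ideal_exp I k))
     <= sdepth_quotient (integral_closure I))%E.
Proof.
case: hI => A ->; rewrite -/(expnt_ideal A) ideal_exp_expnt_ideal.
rewrite !integral_closure_monomial.
set E1 := [set m | exists2 r, _ & expnt_exp (expnt_exp A k) _ _].
set E := [set m | exists2 r, _ & expnt_exp A _ _].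
have E1D m m' : E1 m -> E1 (m + m')%MM.
  move=> [r r0 Am]; exists r => //.
  have -> : ((m + m') *+ r = m *+ r + m' *+ r)%MM.
    by apply/mnmP => i; rewrite mnmDE !mulmnE mnmDE mulnDl.
  exact: expnt_expDr.
have mulmnA m r : ((m *+ k) *+ r = m *+ (k * r))%MM.
  by apply/mnmP => i; rewrite !mulmnE mulnA.
(* A witness r for m also serves for km, by taking k-th powers; a witness r for km gives the witness
   kr for m. *)
have EE1 m : E m <-> E1 (m *+ k)%MM.
  split=> -[r r0 Am]; last first.
    by exists (k * r)%N; rewrite ?muln_gt0 ?hk // -mulmnA -expnt_expM.
  exists r => //; rewrite expnt_expM mulnC.
  have -> : ((m *+ k) *+ r = (m *+ r) *+ k)%MM.
    by apply/mnmP => i; rewrite !mulmnE mulnAC.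
  exact: expnt_exp_mulmn.
(* The empty and the full set of exponents are their own preimages under m |-> km, so the same
   transfer gives both inequalities. *)
have set0E : [set 0] = monomial_span set0 :> set {mpoly K[n]}.
  apply/seteqP; split=> [_ ->|f f0]; first exact: monomial_span0.
  apply/eqP/negPn/negP => /mlead_supp; exact: f0.
have setTE : setT = monomial_span setT :> set {mpoly K[n]} by apply/seteqP.
split.
- by rewrite /sdepth_ideal set0E; apply: (@le_sdepth_root K n E1 set0 E set0 k).
- by rewrite /sdepth_quotient setTE; apply: (@le_sdepth_root K n setT E1 setT E k).
Qed.
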